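(* Let $A$ be a $3$-dimensional evolution algebra over a field $\mathbb{K}$ with zero annihilator and such that $\mathrm{Soc}(A)=A$. Then $A$ is isomorphic to one of the following: (1) a simple evolution algebra; (2) $B\oplus\mathbb{K}$, with $B$ a simple evolution algebra of dimension $2$ and product $(b,\lambda)(b',\lambda')=(bb',\lambda\lambda')$; (3) $\mathbb{K}\oplus\mathbb{K}\oplus\mathbb{K}$ with componentwise product.
   Context: An evolution algebra over $\mathbb{K}$ is a finite-dimensional (not necessarily associative) $\mathbb{K}$-algebra with a basis $\{e_i\}$ (a natural basis) such that $e_ie_j=0$ for $i\neq j$. The annihilator is $\mathrm{ann}(A)=\{x\in A:xA=Ax=0\}$. The socle $\mathrm{Soc}(A)$ of a commutative algebra $A$ is the sum of all minimal ideals $I$ of $A$ with $AI\neq\{0\}$. An algebra is simple if it has nonzero product and no ideals other than $0$ and itself. *)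

(* Defs.v *)
From HB Require Import structures.
From mathcomp Require Import all_boot all_order all_algebra.

Set Implicit Arguments.
Unset Strict Implicit.
Unset Printing Implicit Defensive.

Import GRing.Theory.
Local Open Scope ring_scope.

(* Finite-dimensional algebras, not necessarily associative, commutative or   *)
(* unital: falgType and its ancestors all assume associativity and a unit.    *)
HB.mixin Record Vector_hasBilinearMul (K : fieldType) A of Vector K A := {
  bmul : A -> A -> A;
  bmul_bilinear_subproof : bilinear_for *:%R *:%R bmul
}.

#[short(type="naAlgType")]
HB.structure Definition NonAssocAlgebra (K : fieldType) :=
  {A of Vector K A & Vector_hasBilinearMul K A}.

Notation "x ** y" := (bmul x y)
  (at level 40, left associativity) : ring_scope.

HB.instance Definition _ (K : fieldType) (A : naAlgType K) :=
  bilinear_isBilinear.Build K A A A *:%R *:%R (@bmul K A)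
    bmul_bilinear_subproof.

(* K as an algebra over itself. *)
Section Regular.

Variable K : fieldType.

Fact regular_mul_bilinear :
  bilinear_for *:%R *:%R (fun x y : K^o => (x * y : K^o)).
Proof.
split=> [y a x z|x a y z] /=; rewrite /GRing.scale /=.
  by rewrite mulrDl mulrA.
by rewrite mulrDr mulrCA.
Qed.

HB.instance Definition _ :=
  Vector_hasBilinearMul.Build K K^o regular_mul_bilinear.

End Regular.

(* External direct sum of algebras, with componentwise product. *)
Section DirectSum.

Variables (K : fieldType) (A B : naAlgType K).

Definition pair_bmul (u v : A * B) : A * B := (u.1 ** v.1, u.2 ** v.2).

Fact pair_bmul_bilinear : bilinear_for *:%R *:%R pair_bmul.
Proof.
split=> [v a u w|u a v w]; rewrite /pair_bmul /=.
  by congr (_, _); rewrite linearPl.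
by congr (_, _); rewrite linearPr.
Qed.

HB.instance Definition _ :=
  Vector_hasBilinearMul.Build K (A * B)%type pair_bmul_bilinear.

End DirectSum.

Section Notions.

Variables (K : fieldType) (A : naAlgType K).
Implicit Types (I J : {vspace A}) (x : A).

Definition natural_basis n (e : n.-tuple A) : Prop :=
  basis_of fullv e
  /\ (forall i j : 'I_n, i != j -> tnth e i ** tnth e j = 0).

Definition evolution_algebra : Prop :=
  exists n (e : n.-tuple A), natural_basis e.

Definition in_annihilator x : Prop := forall a : A, x ** a = 0 /\ a ** x = 0.

Definition ideal I : Prop :=
  forall a x : A, x \in I -> a ** x \in I /\ x ** a \in I.

Definition minimal_ideal I : Prop :=
  [/\ ideal I, I != 0%VS
    & forall J, ideal J -> J != 0%VS -> (J <= I)%VS -> J = I].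

(* A I <> {0} *)
Definition acts_nontrivially I : Prop :=
  exists a x : A, x \in I /\ a ** x != 0.

(* The sum of a possibly infinite family of subspaces is the union of the     *)
(* sums of its finite subfamilies.                                            *)
Definition in_socle x : Prop :=
  exists2 s : seq {vspace A},
    forall I, I \in s -> minimal_ideal I /\ acts_nontrivially I
    & x \in (\sum_(I <- s) I)%VS.

Definition simple_algebra : Prop :=
  (exists x y : A, x ** y != 0)
  /\ (forall I, ideal I -> I = 0%VS \/ I = fullv).

End Notions.

Arguments evolution_algebra {K} A.
Arguments simple_algebra {K} A.

Definition isomorphic (K : fieldType) (A B : naAlgType K) : Prop :=
  exists f : {linear A -> B}, bijective f /\ {morph f : x y / x ** y}.

(* Main.v *)
Require Import Defs.
From HB Require Import structures.
From mathcomp Require Import all_boot all_order all_algebra zify.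

Set Implicit Arguments.
Unset Strict Implicit.
Unset Printing Implicit Defensive.

Import GRing.Theory.
Local Open Scope ring_scope.

(** When the socle is everything, minimal ideals can be picked one at a time,
    each meeting the sum of the previous ones trivially, until their sum is
    [A].  In dimension 3 this exhibits [A] as a direct sum of minimal ideals of
    dimensions 3, 2 + 1 or 1 + 1 + 1, and these three patterns are the three
    cases of the classification.

    Distinct minimal ideals annihilate each other.  Hence every [a] of [A] acts
    on a minimal ideal [I] as its component in [I] does
    ([minimal_ideal_action]).  So an ideal of the algebra [I] is already an
    ideal of [A], which makes [I] simple ([minimal_ideal_simple]); and
    [I I <> 0], so a minimal ideal of dimension 1 is spanned by an idempotent
    ([minimal_line_idempotent]) and is a copy of [K].

    The summand of dimension 2 in the second pattern must itself be an
    evolution algebra.  It is the quotient of [A] by the other summand, and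
    the image of a natural basis under a surjective morphism contains a natural
    basis of the target ([evolution_algebra_image]).

    Finally, algebra embeddings whose images annihilate each other and meet
    trivially add up to an embedding of the direct sum ([join_embedding]), which
    is an isomorphism as soon as the dimensions agree
    ([embedding_isomorphic]). *)

(** * Embeddings and direct sums *)

Section Embeddings.

Variable K : fieldType.
Implicit Types A B C : naAlgType K.

Definition embedding A B (f : B -> A) : Prop :=
  injective f /\ {morph f : x y / x ** y}.

Lemma embedding_isomorphic A B (f : {linear B -> A}) :
  embedding f -> \dim {:B} = \dim {:A} -> isomorphic A B.
Proof.
move=> [f_inj fM] dimBA; pose g := linfun f.
have ker_g : lker g == 0%VS.
  by apply/lker0P => x y; rewrite !lfunE => /f_inj.
have gK : cancel g g^-1%VF := lker0_lfunK ker_g.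
have im_g : limg g = fullv.
  apply/eqP; rewrite eqEdim subvf limg_dim_eq ?dimBA ?leqnn //.
  by rewrite (eqP ker_g) capv0.
have gVK : cancel g^-1%VF g by move=> x; rewrite limg_lfunVK ?im_g ?memvf.
exists (g^-1)%VF; split; first by exists g.
move=> x y; apply: (can_inj gK).
by rewrite gVK lfunE /= fM -!(lfunE f) !gVK.
Qed.

Section Join.

Variables (A B C : naAlgType K) (f : {linear B -> A}) (g : {linear C -> A}).

Definition join (u : B * C) : A := f u.1 + g u.2.

Fact join_is_linear : linear join.
Proof. by move=> a u v; rewrite /join !linearP scalerDr addrACA. Qed.

HB.instance Definition _ :=
  GRing.isLinear.Build K (B * C)%type A *:%R join join_is_linear.

Lemma join_embedding :
  embedding f -> embedding g ->
  (forall b c, f b ** g c = 0 /\ g c ** f b = 0) ->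
  (forall b c, f b = g c -> f b = 0) ->
  embedding join.
Proof.
move=> [f_inj fM] [g_inj gM] fg0 fg_disj; split.
  move=> [b c] [b' c']; rewrite /join /= => E.
  have fg : f (b - b') = g (c' - c).
    by apply/eqP; rewrite !linearB subr_eq addrAC [_ + f b']addrC -E addrK.
  have fb0 := fg_disj _ _ fg; have gc0 : g (c' - c) = 0 by rewrite -fg.
  congr (_, _); apply/eqP.
    by rewrite -subr_eq0 -(inj_eq f_inj) fb0 linear0.
  by rewrite eq_sym -subr_eq0 -(inj_eq g_inj) gc0 linear0.
move=> [b c] [b' c']; rewrite /join /= fM gM linearDl !linearDr /=.
by rewrite (fg0 b c').1 (fg0 b' c).2 addr0 add0r.
Qed.

End Join.

Definition scale_by A (u : A) (k : K^o) : A := (k : K) *: u.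

Fact scale_by_is_linear A (u : A) : linear (scale_by u).
Proof. by move=> a k l; rewrite /scale_by scalerDl scalerA. Qed.

HB.instance Definition _ A (u : A) :=
  GRing.isLinear.Build K K^o A *:%R (scale_by u) (scale_by_is_linear u).

Lemma idempotent_embedding A (u : A) :
  u != 0 -> u ** u = u -> embedding (scale_by u).
Proof.
move=> u0 uu; split=> [k l|k l]; rewrite /scale_by; last first.
  by rewrite linearZl linearZr /= uu scalerA.
by move/eqP; rewrite -subr_eq0 -scalerBl scaler_eq0 (negPf u0) orbF subr_eq0
  => /eqP.
Qed.

End Embeddings.

(** * Subspaces as algebras *)

Section SubspaceAlgebra.

Variables (K : fieldType) (A : naAlgType K) (I : {vspace A}).

(** The projection [vsproj I] makes the product total, so the algebra structure
    exists on every subspace; it is the restricted product when [I] is closed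
    under multiplication. *)
Definition subvs_bmul (u v : subvs_of I) : subvs_of I :=
  vsproj I (vsval u ** vsval v).

Fact subvs_bmul_bilinear : bilinear_for *:%R *:%R subvs_bmul.
Proof.
by split=> [v a u w|u a v w];
  rewrite /subvs_bmul /= ?linearPl ?linearPr linearP.
Qed.

HB.instance Definition _ :=
  Vector_hasBilinearMul.Build K (subvs_of I) subvs_bmul_bilinear.

Lemma dim_subvs : \dim {:subvs_of I} = \dim I.
Proof. by rewrite dimvf. Qed.

Lemma vsval_embedding : ideal I -> embedding (vsval : subvs_of I -> A).
Proof.
move=> idI; split; first exact: subvs_inj.
by move=> u v; rewrite /= vsprojK // (idI _ _ (subvsP v)).1.
Qed.

End SubspaceAlgebra.

(** * Images of evolution algebras *)

Section EvolutionImage.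

Variable K : fieldType.
Implicit Types A B : naAlgType K.

(** Both products are recorded because [pairwise] only compares an entry with
    the later ones, and the product is not assumed commutative. *)
Definition orthogonal_pair A (x y : A) : bool :=
  (x ** y == 0) && (y ** x == 0).

Lemma evolution_algebraP A :
  evolution_algebra A <->
  exists2 s : seq A, basis_of fullv s & pairwise (@orthogonal_pair A) s.
Proof.
split=> [[n [e [e_basis e_orth]]]|[s s_basis s_orth]].
  exists e => //; apply/(pairwiseP 0) => i j.
  rewrite !inE size_tuple => lt_in lt_jn lt_ij.
  have e0 k l (lt_kn : (k < n)%N) (lt_ln : (l < n)%N) :
      k != l -> e`_k ** e`_l = 0.
    by move=> kl; have := e_orth (Ordinal lt_kn) (Ordinal lt_ln) kl;
       rewrite !(tnth_nth 0).
  by rewrite /orthogonal_pair !e0 ?eqxx // neq_ltn lt_ij ?orbT.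
exists (size s), (in_tuple s); split=> // i j; rewrite neq_ltn.
rewrite !(tnth_nth 0) /= => /orP[] lt_ij;
  by have /andP[/eqP ? /eqP ?] :=
       (pairwiseP 0 s_orth) _ _ (ltn_ord _) (ltn_ord _) lt_ij.
Qed.

Lemma span_free_subseq (V : vectType K) (s : seq V) :
  exists2 t, subseq t s & free t /\ <<t>>%VS = <<s>>%VS.
Proof.
elim: s => [|x s [t ts [t_free st]]]; first by exists [::]; rewrite ?nil_free.
have [xs|xs] := boolP (x \in <<s>>%VS).
  exists t; first exact: subseq_trans ts (subseq_cons _ _).
  by split=> //; rewrite span_cons st; apply/esym/addv_idPr; rewrite -memvE.
exists (x :: t); first by rewrite /= eqxx.
by split; rewrite ?free_cons ?st ?xs // !span_cons st.
Qed.

(** Orthogonality passes to images and to subfamilies, so one discards from the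
    image of a natural basis the vectors that are linearly redundant. *)
Lemma evolution_algebra_image A B (p : {linear A -> B}) :
  {morph p : x y / x ** y} -> (forall b, exists a, p a = b) ->
  evolution_algebra A -> evolution_algebra B.
Proof.
move=> pM p_surj /evolution_algebraP[s s_basis s_orth].
have [t ts [t_free st]] := span_free_subseq (map p s).
apply/evolution_algebraP; exists t.
  rewrite /basis_of t_free andbT st eqEsubv subvf /=.
  apply/subvP => b _; have [a <-] := p_surj b.
  have -> : map p s = map (linfun p) s.
    by apply: eq_map => x; rewrite lfunE.
  by rewrite -limg_span (span_basis s_basis) -(lfunE p) memv_img ?memvf.
apply: (subseq_pairwise ts); rewrite pairwise_map.
apply: sub_pairwise s_orth => x y /andP[/eqP xy /eqP yx].
by rewrite /orthogonal_pair /= -!pM xy yx linear0 eqxx.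
Qed.

End EvolutionImage.

(** * Minimal ideals *)

Section Ideals.

Variables (K : fieldType) (A : naAlgType K).
Implicit Types (I J L : {vspace A}) (a x y : A).

Lemma ideal_add I J : ideal I -> ideal J -> ideal (I + J)%VS.
Proof.
move=> idI idJ a _ /memv_addP[x xI [y yJ ->]].
have [axI xaI] := idI a x xI; have [ayJ yaJ] := idJ a y yJ.
by rewrite linearDl linearDr /= !memv_add.
Qed.

Lemma ideal_cap I J : ideal I -> ideal J -> ideal (I :&: J)%VS.
Proof.
move=> idI idJ a x /memv_capP[xI xJ].
have [axI xaI] := idI a x xI; have [axJ xaJ] := idJ a x xJ.
by rewrite !memv_cap axI xaI axJ xaJ.
Qed.

Lemma disjoint_memv0 I J x : (I :&: J = 0)%VS -> x \in I -> x \in J -> x = 0.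
Proof.
by move=> IJ0 xI xJ; apply/eqP; rewrite -memv0 -IJ0 memv_cap xI xJ.
Qed.

Lemma disjoint_ideals_mul0 I J x y :
  ideal I -> ideal J -> (I :&: J = 0)%VS -> x \in I -> y \in J ->
  x ** y = 0 /\ y ** x = 0.
Proof.
move=> idI idJ IJ0 xI yJ.
have [yxI xyI] := idI y x xI; have [xyJ yxJ] := idJ x y yJ.
by split; apply: (disjoint_memv0 IJ0).
Qed.

Lemma minimal_ideal_cap I J :
  minimal_ideal I -> ideal J -> (I <= J)%VS \/ (I :&: J = 0)%VS.
Proof.
move=> [idI _ minI] idJ;
have [->|IJn0] := eqVneq (I :&: J)%VS 0%VS; first by right.
by left; apply/capv_idPl/minI; rewrite ?capvSl //; apply: ideal_cap.
Qed.

(** Projecting along the other summand is multiplicative, as the two summands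
    annihilate each other. *)
Lemma complemented_ideal_evolution I J :
  ideal I -> ideal J -> (I :&: J = 0)%VS -> (I + J = fullv)%VS ->
  evolution_algebra A -> evolution_algebra (subvs_of I).
Proof.
move=> idI idJ IJ0 IJf;
pose p := (linfun (vsproj I) \o daddv_pi I J)%VF.
have pI x : x \in I -> p x = vsproj I x.
  by move=> xI; rewrite /p comp_lfunE lfunE /= daddv_pi_id.
have pD x y : x \in I -> y \in J -> p (x + y) = vsproj I x.
  move=> xI yJ; rewrite linearD /= pI // [p y](_ : _ = 0) ?addr0 //.
  rewrite /p comp_lfunE [X in linfun _ X](_ : _ = 0) ?linear0 //.
  have := daddv_pi_add IJ0 (_ : y \in I + J)%VS.
  rewrite IJf memvf => /(_ isT).
  rewrite (daddv_pi_id _ yJ) ?(capvC J) //.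
  by move/(canRL (addrK _)); rewrite subrr.
apply: (evolution_algebra_image (p := p)) => [a b|b]; last first.
  by exists (vsval b); rewrite /= pI ?subvsP // vsvalK.
have decomp c : exists x, exists2 y, (x \in I) && (y \in J) & c = x + y.
  have : c \in (I + J)%VS by rewrite IJf memvf.
  by case/memv_addP=> x xI [y yJ ->]; exists x, y; rewrite ?xI.
have [x [y /andP[xI yJ] ->]] := decomp a.
have [x' [y' /andP[xI' yJ'] ->]] := decomp b.
rewrite linearDl !linearDr /=.
rewrite (disjoint_ideals_mul0 idI idJ IJ0 xI yJ').1.
rewrite (disjoint_ideals_mul0 idI idJ IJ0 xI' yJ).2 addr0 add0r.
have xx'I := (idI x x' xI').1; have yy'J := (idJ y y' yJ').1.
by rewrite !pD //; apply: val_inj; rewrite /= !vsprojK.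
Qed.

Section FullSocle.

Hypothesis socA : forall x, in_socle x.

(** A factor of [A] lies in a sum of minimal ideals, and those different from
    [I] kill [I]: only the component in [I] acts. *)
Lemma minimal_ideal_action I a :
  minimal_ideal I ->
  exists2 c, c \in I & forall x, x \in I -> a ** x = c ** x /\ x ** a = x ** c.
Proof.
move=> minI; have [s minS] := socA a.
elim: s a minS => [|J s IHs] a minS.
  rewrite big_nil memv0 => /eqP->; exists 0 => //; exact: mem0v.
rewrite big_cons => /memv_addP[y yJ [z zs ->]].
have [L Ls|c cI cE] := IHs z _ zs; first by apply: minS; rewrite inE Ls orbT.
have [minJ _] := minS J (mem_head _ _).
have [idI In0 _] := minI; have [idJ _ uniqJ] := minJ.
have [IJ|IJ0] := minimal_ideal_cap minI idJ.
  have yI : y \in I by rewrite (uniqJ I).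
  exists (y + c); first exact: rpredD.
  by move=> x xI; have [zx xz] := cE x xI; rewrite !linearDl !linearDr /= zx xz.
exists c => // x xI; have [zx xz] := cE x xI.
have [xy yx] := disjoint_ideals_mul0 idI idJ IJ0 xI yJ.
by rewrite linearDl linearDr /= zx xz xy yx !add0r.
Qed.

Lemma minimal_ideal_mul_neq0 I :
  minimal_ideal I -> acts_nontrivially I ->
  exists x y, [/\ x \in I, y \in I & x ** y != 0].
Proof.
move=> minI [a [x [xI ax]]]; have [c cI cE] := minimal_ideal_action a minI.
by exists c, x; split=> //; rewrite -(cE x xI).1.
Qed.

(** Multiplying by [a] preserves an ideal [L] of the algebra [I], because some
    [c] of [I] acts on [I] in the same way; so [L] is an ideal of [A], and
    minimality applies. *)
Lemma minimal_ideal_simple I :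
  minimal_ideal I -> acts_nontrivially I -> simple_algebra (subvs_of I).
Proof.
move=> minI actI; have [idI _ uniqI] := minI.
have [_ vM] := vsval_embedding idI.
split.
  have [x [y [xI yI xy]]] := minimal_ideal_mul_neq0 minI actI.
  exists (vsproj I x), (vsproj I y); apply: contraNneq xy.
  by move/(congr1 vsval); rewrite vM !vsprojK // linear0 => ->.
move=> L idL; pose v := linfun (vsval : subvs_of I -> A).
pose L' := (v @: L)%VS.
have L'I : (L' <= I)%VS.
  by apply/subvP => _ /memv_imgP[u _ ->]; rewrite lfunE subvsP.
have idL' : ideal L'.
  move=> a _ /memv_imgP[u uL ->]; rewrite lfunE /=.
  have [c cI cE] := minimal_ideal_action a minI.
  have [-> ->] := cE _ (subvsP u).
  have [cuL ucL] := idL (vsproj I c) u uL.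
  rewrite -{1 2}(vsprojK cI) -!vM -!(lfunE (vsval : subvs_of I -> A)).
  by split; apply: memv_img.
have v_inj : lker v == 0%VS.
  by apply/lker0P => x y; rewrite !lfunE => /subvs_inj.
have dimL' : \dim L' = \dim L.
  by rewrite limg_dim_eq // (eqP v_inj) capv0.
have [L'0|L'n0] := eqVneq L' 0%VS.
  by left; apply/eqP; rewrite -dimv_eq0 -dimL' L'0 dimv0.
right; apply/eqP; rewrite eqEdim subvf dim_subvs -dimL' /=.
by rewrite (uniqI L').
Qed.

Lemma minimal_line_idempotent I :
  minimal_ideal I -> acts_nontrivially I -> \dim I = 1%N ->
  exists u, [/\ u \in I, u != 0 & u ** u = u].
Proof.
move=> minI actI dimI.
have [idI In0 _] := minI.
have [x [y [xI yI xy]]] := minimal_ideal_mul_neq0 minI actI.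
have x0 : x != 0 by apply: contraNneq xy => ->; rewrite linear0l.
have Ix : (I = <[x]>)%VS.
  by apply/esym/eqP; rewrite eqEdim -memvE xI dim_vline x0 dimI.
move: yI (idI x x xI).1; rewrite Ix => /vlineP[k yE] /vlineP[c xxE].
have c0 : c != 0.
  by apply: contraNneq xy => c0; rewrite yE linearZr /= xxE c0 scale0r scaler0.
exists (c^-1 *: x); split.
- by rewrite memvZ ?memv_line.
- by rewrite scaler_eq0 invr_eq0 negb_or c0.
- by rewrite linearZl linearZr /= xxE !scalerA -mulrA mulVf // mulr1.
Qed.

(** If [J] contained every minimal ideal of the socle, it would contain [A]; and
    one that [J] does not contain meets [J] trivially. *)
Lemma minimal_ideal_avoiding J :
  ideal J -> J != fullv ->
  exists I, [/\ minimal_ideal I, acts_nontrivially I & (I :&: J = 0)%VS].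
Proof.
move=> idJ; rewrite eqEsubv subvf /= => /subvPn[x _ xJ].
have [s minS xs] := socA x.
have [sJ|/allPn[I Is IJ]] := boolP (all (fun I => I <= J)%VS s).
  case/negP: xJ; apply: subvP x xs; rewrite big_seq.
  by elim/big_ind: _ => [|U V UJ VJ|I Is];
    [exact: sub0v | rewrite subv_add UJ | exact: (allP sJ)].
have [minI actI] := minS I Is.
exists I; split=> //.
by have [IJ'|//] := minimal_ideal_cap minI idJ; rewrite IJ' in IJ.
Qed.

End FullSocle.

End Ideals.

(** * Classification in dimension 3 *)

Section Patterns.

Variables (K : fieldType) (A : naAlgType K).
Implicit Types I J : {vspace A}.
Hypothesis socA : forall x : A, in_socle x.

Lemma ideal_line_isomorphic I J :
  ideal I -> minimal_ideal J -> acts_nontrivially J ->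
  \dim J = 1%N -> (I :&: J = 0)%VS -> (I + J = fullv)%VS ->
  isomorphic A (subvs_of I * K^o)%type.
Proof.
move=> idI minJ actJ dimJ IJ0 IJf; have [idJ _ _] := minJ.
have [u [uJ u0 uu]] := minimal_line_idempotent socA minJ actJ dimJ.
have kuJ k : scale_by u k \in J by apply: memvZ.
apply: (@embedding_isomorphic _ _ _ (join vsval (scale_by u))).
  apply: join_embedding.
  - exact: vsval_embedding.
  - exact: idempotent_embedding.
  - move=> b k.
    exact: (disjoint_ideals_mul0 idI idJ IJ0 (subvsP b) (kuJ k)).
  - move=> b k E; apply: (disjoint_memv0 IJ0 (subvsP b)).
    by rewrite [vsval b]E; apply: kuJ.
by rewrite -IJf (dimv_disjoint_sum IJ0) dimJ !dimvf.
Qed.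

Lemma three_lines_isomorphic I1 I2 I3 :
  minimal_ideal I1 -> acts_nontrivially I1 -> \dim I1 = 1%N ->
  minimal_ideal I2 -> acts_nontrivially I2 -> \dim I2 = 1%N ->
  minimal_ideal I3 -> acts_nontrivially I3 -> \dim I3 = 1%N ->
  (I1 :&: I2 = 0)%VS -> ((I1 + I2) :&: I3 = 0)%VS -> \dim {:A} = 3%N ->
  isomorphic A (K^o * K^o * K^o)%type.
Proof.
move=> min1 act1 dim1 min2 act2 dim2 min3 act3 dim3 I12 I123 dimA.
have [id1 _ _] := min1; have [id2 _ _] := min2; have [id3 _ _] := min3.
have [u [u1 u0 uu]] := minimal_line_idempotent socA min1 act1 dim1.
have [v [v2 v0 vv]] := minimal_line_idempotent socA min2 act2 dim2.
have [w [w3 w0 ww]] := minimal_line_idempotent socA min3 act3 dim3.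
have ku k : scale_by u k \in I1 by apply: memvZ.
have kv k : scale_by v k \in I2 by apply: memvZ.
have kw k : scale_by w k \in I3 by apply: memvZ.
have kuv k : join (scale_by u) (scale_by v) k \in (I1 + I2)%VS.
  exact: memv_add (ku _) (kv _).
have id12 := ideal_add id1 id2.
apply: (@embedding_isomorphic _ _ _
  (join (join (scale_by u) (scale_by v)) (scale_by w))); last first.
  by rewrite dimA !dimvf.
apply: join_embedding.
- apply: join_embedding; try exact: idempotent_embedding.
    move=> k l.
    exact: (disjoint_ideals_mul0 id1 id2 I12 (ku k) (kv l)).
  move=> k l E; apply: (disjoint_memv0 I12 (ku k)).
  by rewrite [scale_by u k]E; apply: kv.
- exact: idempotent_embedding.
- move=> k l.
  exact: (disjoint_ideals_mul0 id12 id3 I123 (kuv k) (kw l)).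
- move=> k l E; apply: (disjoint_memv0 I123 (kuv k)).
  by rewrite [join _ _ k]E; apply: kw.
Qed.

End Patterns.

Lemma isomorphic_refl (K : fieldType) (A : naAlgType K) : isomorphic A A.
Proof. by exists idfun; split=> //; exists id. Qed.

Theorem proposition6p3 (K : fieldType) (A : naAlgType K) :
  evolution_algebra A ->
  \dim {:A} = 3%N ->
  (forall x : A, in_annihilator x -> x = 0) ->
  (forall x : A, in_socle x) ->
  [\/ exists B : naAlgType K,
        [/\ evolution_algebra B, simple_algebra B & isomorphic A B],
      exists B : naAlgType K,
        [/\ evolution_algebra B, simple_algebra B, \dim {:B} = 2%N
          & isomorphic A (B * K^o)%type]
    | isomorphic A (K^o * K^o * K^o)%type].
Proof.
move=> evA dimA _ socA.
have dim_gt0 (I : {vspace A}) : minimal_ideal I -> (0 < \dim I)%N.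
  by case=> _ In0 _; rewrite lt0n dimv_eq0.
have id0 : ideal (0%VS : {vspace A}).
  by move=> a x; rewrite memv0 => /eqP->; rewrite linear0l linear0r mem0v.
have n0 : 0%VS != fullv :> {vspace A} by rewrite eq_sym -dimv_eq0 dimA.
have [I1 [min1 act1 _]] := minimal_ideal_avoiding socA id0 n0.
have [id1 _ uniq1] := min1.
have [f1|n1] := eqVneq I1 fullv.
  apply: Or31; exists A; split=> //; last exact: isomorphic_refl.
  have [a [x [_ ax]]] := act1; split; first by exists a, x.
  move=> I idI; have [->|In0] := eqVneq I 0%VS; first by left.
  by right; rewrite -f1; apply: uniq1 => //; rewrite f1 subvf.
have [I2 [min2 act2 I21]] := minimal_ideal_avoiding socA id1 n1.
have [id2 _ _] := min2.
have I12 : (I1 :&: I2 = 0)%VS by rewrite capvC.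
have plane_line (I J : {vspace A}) :
    minimal_ideal I -> acts_nontrivially I ->
    minimal_ideal J -> acts_nontrivially J ->
    (I :&: J = 0)%VS -> (I + J = fullv)%VS -> \dim J = 1%N ->
  exists B : naAlgType K,
    [/\ evolution_algebra B, simple_algebra B, \dim {:B} = 2%N
      & isomorphic A (B * K^o)%type].
  move=> minI actI minJ actJ IJ0 IJf dimJ.
  have [idI _ _] := minI; have [idJ _ _] := minJ.
  exists (subvs_of I); split.
  - exact: complemented_ideal_evolution IJ0 IJf evA.
  - exact: minimal_ideal_simple.
  - apply/eqP; rewrite dim_subvs -(eqn_add2r (\dim J)).
    by rewrite -(dimv_disjoint_sum IJ0) IJf dimA dimJ.
  - exact: ideal_line_isomorphic idI minJ actJ dimJ IJ0 IJf.
have d1 := dim_gt0 _ min1; have d2 := dim_gt0 _ min2.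
have d12 := dimv_disjoint_sum I12.
have [f12|n12] := eqVneq (I1 + I2)%VS fullv.
  apply: Or32; move: d12; rewrite f12 dimA.
  have [e2 _|ne2 dsum] := eqVneq (\dim I2) 1%N; first exact: (plane_line I1 I2).
  apply: (plane_line I2 I1) => //; first by rewrite addvC.
  lia.
have [I3 [min3 act3]] := minimal_ideal_avoiding socA (ideal_add id1 id2) n12.
rewrite capvC => I123.
have d3 := dim_gt0 _ min3.
have d123 : (\dim I1 + \dim I2 + \dim I3 <= 3)%N.
  by rewrite -d12 -(dimv_disjoint_sum I123) -dimA dimvS ?subvf.
have [e1 e2 e3] : [/\ \dim I1 = 1, \dim I2 = 1 & \dim I3 = 1]%N.
  by split; lia.
apply: Or33.
by apply: (three_lines_isomorphic socA (I1 := I1) (I2 := I2) (I3 := I3)).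
Qed.
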